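(* Let $\mathcal F$ be a free filter on a countably infinite alphabet $A$ and let $\mathbb P=L_{\mathcal F}(A)$. Let $\mathcal C$ be a nonempty countable set of codes, $(u_n)_{n<\omega}$ a sequence in $\mathcal C$ in which every code recurs infinitely often, and $C_n\subseteq A$ for $n<\omega$. Put $I=\{n:C_n\in\mathcal F\}$ and $$X_{\mathrm{cert}}=\bigcap_{u\in\mathcal C}\ \bigcup_{n:u_n=u}\{g\in A^\omega:g(n)\in C_n\}.$$ Suppose that $\{n\in I:u_n=u\}$ is unbounded in $\omega$ for every code $u\in\mathcal C$. Then $$\mathcal D_{\mathrm{cert}}=\{T\in\mathbb P:[T]\subseteq X_{\mathrm{cert}}\}$$ is dense in $\mathbb P$. More precisely, every $T\in\mathbb P$ has a strengthening $T^*\le T$ with the same stem such that every $g\in[T^*]$ satisfies $g(n)\in C_n$ whenever $n\in I$ and $n\ge|\operatorname{stem}(T)|$. If $I=\omega$, every such branch is accepted (i.e. $g(n)\in C_n$) at every stage $n$ beyond the stem.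
   Context: A filter on $A$ is free if it contains every cofinite subset of $A$ and no finite set. The conditions of $L_{\mathcal F}(A)$ are the nonempty trees $T\subseteq A^{<\omega}$, closed under initial segments, with a stem $\operatorname{stem}(T)$ (the longest node common to all branches; below it the tree has one path) such that for every $t\in T$ with $t\supseteq\operatorname{stem}(T)$ the set $\operatorname{Succ}_T(t)=\{a:t^\frown a\in T\}$ belongs to $\mathcal F$; the order is $S\le T$ iff $S\subseteq T$. The body is $[T]=\{x\in A^\omega:\forall n\ x\restriction n\in T\}$. *)

(* Defs.v *)
From mathcomp Require Export all_boot.
From mathcomp Require Export boolp classical_sets functions cardinality filter.

Set Implicit Arguments.
Unset Strict Implicit.
Unset Printing Implicit Defensive.

Local Open Scope classical_set_scope.

(* [Filter] alone does not exclude the improper filter; the last clause does. *)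
Definition free_filter (A : Type) (F : set_system A) : Prop :=
  [/\ Filter F,
      forall S : set A, cofinite_set S -> F S
    & forall S : set A, finite_set S -> ~ F S].

(* Finite sequences A^{<omega} are [seq A], infinite ones A^omega are
   [nat -> A], and the restriction x|n is [mkseq x n]. *)
Definition is_tree (A : eqType) (T : set (seq A)) : Prop :=
  T !=set0 /\ forall s t : seq A, prefix s t -> T t -> T s.

Definition body (A : Type) (T : set (seq A)) : set (nat -> A) :=
  [set x | forall n : nat, T (mkseq x n)].

Definition Succ (A : Type) (T : set (seq A)) (t : seq A) : set A :=
  [set a | T (rcons t a)].

Definition on_all_branches (A : Type) (T : set (seq A)) (s : seq A) : Prop :=
  forall x, body T x -> mkseq x (size s) = s.

(* The last clause says that below s the tree consists of a single path. A tree
   has at most one stem; it need not have any. *)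
Definition is_stem (A : eqType) (T : set (seq A)) (s : seq A) : Prop :=
  [/\ T s,
      on_all_branches T s,
      forall s' : seq A, T s' -> on_all_branches T s' -> size s' <= size s
    & forall t : seq A, T t -> size t <= size s -> prefix t s].

(* The conditions of L_F(A). The order of the forcing is inclusion. *)
Definition laver (A : eqType) (F : set_system A) : set (set (seq A)) :=
  [set T | is_tree T /\
           exists2 s : seq A, is_stem T s &
             forall t : seq A, T t -> prefix s t -> F (Succ T t)].

Definition forcing_dense (A : Type) (P D : set (set (seq A))) : Prop :=
  D `<=` P /\ forall T, P T -> exists2 S, D S & S `<=` T.

Definition unbounded (S : set nat) : Prop :=
  forall m : nat, exists2 n : nat, S n & m <= n.

Definition large_stages (A : Type) (F : set_system A) (Cs : nat -> set A) :
  set nat := [set n | F (Cs n)].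

Definition X_cert (A U : Type) (C : set U) (u : nat -> U)
    (Cs : nat -> set A) : set (nat -> A) :=
  \bigcap_(v in C) \bigcup_(n in [set n | u n = v]) [set g | Cs n (g n)].

Definition D_cert (A : eqType) (U : Type) (F : set_system A) (C : set U)
    (u : nat -> U) (Cs : nat -> set A) : set (set (seq A)) :=
  [set T | laver F T /\ body T `<=` X_cert C u Cs].

(* Main.v *)
(* Keep only those nodes of T all of whose entries at large stages n beyond the
   stem lie in C_n. At every node this intersects the successor set with at most
   one member of F, so the successor sets stay in F. Because members of a free
   filter are infinite, the pruned tree still splits at the stem, which is
   therefore unchanged. *)
Require Import Defs.

Set Implicit Arguments.
Unset Strict Implicit.
Unset Printing Implicit Defensive.

Local Open Scope classical_set_scope.

(** Maximality makes the two lengths equal, and the path clause then forces equality. This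
    identifies the stem that [laver] only asserts to exist with the one fixed in advance. *)
Lemma stem_unique (A : eqType) (T : set (seq A)) (s1 s2 : seq A) :
  is_stem T s1 -> is_stem T s2 -> s1 = s2.
Proof.
move=> [T1 br1 max1 _] [T2 br2 max2 path2].
have le12 : size s1 <= size s2 by exact: max2.
have le21 : size s2 <= size s1 by exact: max1.
have := path2 _ T1 le12.
by rewrite prefixE take_oversize // => /eqP.
Qed.

Lemma free_filter_neq (A : eqType) (F : set_system A) (S : set A) (a : A) :
  free_filter F -> F S -> exists2 b, S b & b <> a.
Proof.
move=> [_ _ Ffin] FS; apply: contrapT => noS; apply: (Ffin S) => //.
apply: (@sub_finite_set _ _ [set a]); last exact: finite_set1.
by move=> b Sb /=; apply: contrapT => ba; apply: noS; exists b.
Qed.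

Lemma free_filter_nonempty (A : Type) (F : set_system A) (S : set A) :
  free_filter F -> F S -> S !=set0.
Proof.
move=> [_ _ Ffin] FS; apply/set0P/eqP => S0.
by apply: (Ffin S) => //; rewrite S0; exact: finite_set0.
Qed.

(** Iterating a choice of successors from [t] builds a branch. Stems are defined through branches,
    so this is what turns splitting at a node into distinct branches. *)
Lemma branch_through (A : eqType) (T : set (seq A)) (t : seq A) :
  is_tree T -> T t -> (forall r, T r -> prefix t r -> Succ T r !=set0) ->
  exists2 x, body T x & mkseq x (size t) = t.
Proof.
move=> [_ Tpre] Tt Tsucc; have [a0 _] := Tsucc t Tt (prefix_refl t).
(* The choice function must be total; off the part of [T] above [t] it takes the dummy value
   [a0]. *)
have /boolp.choice[f fP] : forall r, exists a,
    T r -> prefix t r -> T (rcons r a).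
  move=> r; case: (boolp.pselect (T r /\ prefix t r)) => [[Tr tr]|nTr].
    by have [a Ta] := Tsucc r Tr tr; exists a.
  by exists a0 => Tr tr; case: nTr.
pose node k := iter k (fun r => rcons r (f r)) t.
have nodeP k : T (node k) /\ prefix t (node k).
  elim: k => [|k [Tk tk]]; first by split=> //; exact: prefix_refl.
  by split; [exact: fP | exact: prefix_trans tk (prefix_rcons _ _)].
have size_node k : size (node k) = size t + k.
  by elim: k => [|k IHk]; rewrite ?addn0 //= size_rcons IHk addnS.
have node_mono k j : prefix (node k) (node (k + j)).
  elim: j => [|j IHj]; first by rewrite addn0; exact: prefix_refl.
  by rewrite addnS; exact: prefix_trans IHj (prefix_rcons _ _).
(* [node n.+1] has length [size t + n.+1], so position [n] exists and the default [a0] is never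
   read. *)
pose x n := nth a0 (node n.+1) n.
have lt_node i : i < size (node i.+1) by rewrite size_node addnS ltnS leq_addl.
have xE k i : i < size (node k) -> x i = nth a0 (node k) i.
  (* The nodes are nested: the longer of [node i.+1] and [node k] extends the other, and position
     [i] lies in both. *)
  move=> ik; rewrite /x; case: (leqP i.+1 k) => [le_ik|lt_ki].
    have /prefixP[r] := node_mono i.+1 (k - i.+1).
    by rewrite subnKC // => ->; rewrite nth_cat lt_node.
  have /prefixP[r] := node_mono k (i.+1 - k).
  by rewrite subnKC 1?ltnW // => ->; rewrite nth_cat ik.
have xtake k m : m <= size (node k) -> mkseq x m = take m (node k).
  move=> mk; apply: (@eq_from_nth _ a0).
    by rewrite size_mkseq size_takel.
  move=> i; rewrite size_mkseq => im.
  by rewrite nth_mkseq // nth_take // (xE k) // (leq_trans im).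
exists x => [m|]; last by rewrite (xtake 0) ?take_size.
rewrite (xtake m) ?size_node ?leq_addl //.
by apply: Tpre (nodeP m).1; exact: prefix_take.
Qed.

Lemma prefix_rconsP (A : eqType) (r t : seq A) (b a : A) :
  prefix (rcons r b) (rcons t a) ->
  prefix (rcons r b) t \/ r = t /\ b = a.
Proof.
case/prefixP=> q; case/lastP: q => [|q c].
  by rewrite cats0 => /rcons_inj[-> ->]; right.
by rewrite -rcons_cat => /rcons_inj[-> _]; left; exact: prefix_prefix.
Qed.

(** An initial segment [rcons r a] of [t] encodes that the entry of [t] at position [size r] is [a].
    This avoids a default letter and makes closure under initial segments immediate. *)
Definition prune (A : eqType) (F : set_system A) (Cs : nat -> set A)
    (s : seq A) (T : set (seq A)) : set (seq A) :=
  [set t | T t /\ forall r a, prefix (rcons r a) t -> size s <= size r ->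
             F (Cs (size r)) -> Cs (size r) a].

Section Prune.
Variables (A : eqType) (F : set_system A) (Cs : nat -> set A).
Variables (s : seq A) (T : set (seq A)).
Hypotheses (freeF : free_filter F) (laverT : laver F T) (stemT : is_stem T s).

Let Tstar := prune F Cs s T.

Lemma prune_sub : Tstar `<=` T.
Proof. by move=> t []. Qed.

Lemma prune_stem_mem : Tstar s.
Proof.
(* Vacuous: every position inside [s] is below [size s]. *)
have [Ts _ _ _] := stemT; split=> // r a /size_prefix.
by rewrite size_rcons ltnNge => /negP.
Qed.

Lemma prune_tree : is_tree Tstar.
Proof.
have [[_ Tpre] _] := laverT.
split=> [|r t rt [Tt Ct]]; first by exists s; exact: prune_stem_mem.
split=> [|q a qr]; first exact: Tpre Tt.
by apply: Ct; exact: prefix_trans rt.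
Qed.

Lemma prune_Succ t : Tstar t -> prefix s t -> F (Succ Tstar t).
Proof.
move=> [Tt Ct] st; have [FF _ _] := freeF.
have [_ [s' stemT' FSucc]] := laverT.
have FT : F (Succ T t) by apply: FSucc => //; rewrite (stem_unique stemT' stemT).
(* This set is [Cs (size t)] at a large stage and all of [A] otherwise. *)
have FC : F [set a | F (Cs (size t)) -> Cs (size t) a].
  case: (boolp.pselect (F (Cs (size t)))) => [FCt|nFCt].
    by apply: filterS FCt => a Ca _.
  by apply: filterS filterT => a _ /nFCt.
apply: filterS (filterI FT FC) => a [Ta Ca]; split=> // r b.
by case/prefix_rconsP=> [/Ct //|[-> ->]].
Qed.

Lemma prune_stem : is_stem Tstar s.
Proof.
have [Ts brs _ paths] := stemT.
split; [exact: prune_stem_mem | | | by move=> t /prune_sub; exact: paths].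
  by move=> x xT; apply: brs => n; exact: prune_sub (xT n).
(* Only maximality is not inherited from [T]. Two distinct successors [a] and [b] of [s] each extend
   to a branch of [Tstar], so a longer common node [s'] would have both letters at position
   [size s]. *)
move=> s' _ brs'; rewrite leqNgt; apply/negP => lt_ss'.
have FS := prune_Succ prune_stem_mem (prefix_refl s).
have [a Sa] := free_filter_nonempty freeF FS.
have [b Sb] := free_filter_neq a freeF FS; apply.
have through c : Succ Tstar s c -> take (size s).+1 s' = rcons s c.
  move=> Sc; have [] := branch_through prune_tree Sc.
    move=> r Tr cr; apply: free_filter_nonempty freeF (prune_Succ Tr _).
    exact: prefix_trans (prefix_rcons _ _) cr.
  move=> x xT; rewrite size_rcons => <-; rewrite -(brs' x xT).
  by rewrite /mkseq -map_take take_iota (minn_idPl _).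
by have := through b Sb; rewrite (through a Sa) => /rcons_inj[].
Qed.

Lemma prune_laver : laver F Tstar.
Proof.
split; first exact: prune_tree.
by exists s; [exact: prune_stem | move=> t; exact: prune_Succ].
Qed.

Lemma prune_body g n :
  body Tstar g -> F (Cs n) -> size s <= n -> Cs n (g n).
Proof.
(* The restriction to [n.+1] is the shortest one containing the entry at position [n]. *)
move=> /(_ n.+1)[_ gC] FC sn; have := gC (mkseq g n) (g n).
by rewrite size_mkseq mkseqS; apply=> //; exact: prefix_refl.
Qed.

End Prune.

Theorem theorem9p2 (A : eqType) (F : set_system A) (U : Type) (C : set U)
    (u : nat -> U) (Cs : nat -> set A)
    (hA : ([set: A] #= [set: nat])%card)
    (hF : free_filter F)
    (hC0 : C !=set0)
    (hC : countable C)
    (hu : forall n : nat, C (u n))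
    (hrec : forall v : U, C v -> infinite_set [set n | u n = v])
    (hunb : forall v : U, C v ->
       unbounded [set n | large_stages F Cs n /\ u n = v]) :
  forcing_dense (laver F) (D_cert F C u Cs) /\
  (forall (T : set (seq A)) (s : seq A), laver F T -> is_stem T s ->
     exists Tstar : set (seq A),
       [/\ laver F Tstar,
           Tstar `<=` T,
           is_stem Tstar s,
           forall g : nat -> A, body Tstar g ->
             forall n : nat, large_stages F Cs n -> size s <= n -> Cs n (g n)
         & large_stages F Cs = [set: nat] ->
             forall g : nat -> A, body Tstar g ->
               forall n : nat, size s <= n -> Cs n (g n)]).
Proof.
split; last first.
  move=> T s PT sT; exists (prune F Cs s T); split.
  - exact: prune_laver.
  - exact: prune_sub.
  - exact: prune_stem.
  - by move=> g gT n; exact: prune_body gT.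
  - move=> I_all g gT n; apply: prune_body gT _.
    by have : setT n by []; rewrite -I_all.
split=> [T []//|T PT]; have [_ [s sT _]] := PT.
exists (prune F Cs s T); last exact: prune_sub.
split=> [|g gT v Cv]; first exact: prune_laver.
(* One large stage with code [v] beyond the stem suffices, since [X_cert] asks for a single hit per
   code. *)
have [n [FC un] sn] := hunb v Cv (size s).
by exists n => //; exact: prune_body gT FC sn.
Qed.
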